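(* Let $A$ be a perinormal ring with total quotient ring $K$. If $B$ is an overring of $A$ such that the extension $A\subseteq B$ is integral and unibranched, then $A=B$. In particular, if $b\in K$ and $b^2,b^3\in A$, then $b\in A$.
   Context: All rings are commutative with unity. For a ring $A$, $\mathrm{Reg}(A)$ is the set of regular elements (non-zero-divisors) of $A$, and the total quotient ring $K$ of $A$ is the fraction ring of $A$ with denominators in $\mathrm{Reg}(A)$. An overring of $A$ is a ring $B$ with $A\subseteq B\subseteq K$. A ring extension $A\subseteq B$ satisfies going down if, whenever $P_1\subseteq P_2$ are prime ideals of $A$ and $Q_2$ is a prime ideal of $B$ with $Q_2\cap A=P_2$, there is a prime ideal $Q_1\subseteq Q_2$ of $B$ with $Q_1\cap A=P_1$. A GD-overring of $A$ is an overring $B$ of $A$ such that $A\subseteq B$ satisfies going down. A ring $A$ is perinormal if every GD-overring of $A$ is flat as an $A$-module. A ring extension $A\subseteq B$ is unibranched if the contraction map $\mathrm{Spec}(B)\rightarrow \mathrm{Spec}(A)$, $Q\mapsto Q\cap A$, is bijective. *)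

(* Defs.v *)
From HB Require Import structures.
From mathcomp Require Import all_boot all_algebra.
From mathcomp Require Import boolp classical_sets functions.

Set Implicit Arguments.
Unset Strict Implicit.
Unset Printing Implicit Defensive.

Import GRing.Theory.
Local Open Scope classical_set_scope.
Local Open Scope ring_scope.

(* Rings are [comPzRingType]s, so that the zero ring is allowed; this is why
   [idealr_closed], [integralOver] and [comAlgType], which require 1 != 0,
   are not used.  A ring extension A <= B is an injective ring morphism
   f : A -> B, and the contraction of Q to A is f @^-1` Q. *)

Definition prime_ideal (R : comPzRingType) (P : set R) : Prop :=
  [/\ P 0,
      forall x y, P x -> P y -> P (x + y),
      forall a x, P x -> P (a * x),
      ~ P 1
    & forall x y, P (x * y) -> P x \/ P y].

Definition Spec (R : comPzRingType) : set (set R) := [set P | prime_ideal P].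
Arguments Spec : clear implicits.

Section RingExtensions.
Variables (A B : comPzRingType) (f : {rmorphism A -> B}).

Definition going_down : Prop :=
  forall (P1 P2 : set A) (Q2 : set B),
    Spec A P1 -> Spec A P2 -> P1 `<=` P2 ->
    Spec B Q2 -> f @^-1` Q2 = P2 ->
    exists Q1 : set B, [/\ Spec B Q1, Q1 `<=` Q2 & f @^-1` Q1 = P1].

Definition unibranched : Prop :=
  set_bij (Spec B) (Spec A) (fun Q => f @^-1` Q).

Definition integral_ext : Prop :=
  forall b : B, exists (n : nat) (c : 'I_n -> A),
    b ^+ n + \sum_(i < n) f (c i) * b ^+ i = 0.

End RingExtensions.

Section TensorProduct.
Variables (A : comPzRingType) (M N : lmodType A).

(* A sequence [:: (x1, y1); ...; (xn, yn)] stands for the formal sum of the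
   symbols x_i (x) y_i.  [tensor_eq] is the congruence on the free commutative
   monoid on M * N generated by the bilinearity relations.  The rule [teq_zero]
   identifies the symbol 0 (x) y with the empty sum; it would be redundant over
   the free abelian group, and it makes (- x) (x) y an opposite of x (x) y, so
   that the quotient is the underlying group of the tensor product over A. *)
Inductive tensor_eq : seq (M * N) -> seq (M * N) -> Prop :=
| teq_refl s : tensor_eq s s
| teq_sym s t : tensor_eq s t -> tensor_eq t s
| teq_trans s t u : tensor_eq s t -> tensor_eq t u -> tensor_eq s u
| teq_cat s s' t t' :
    tensor_eq s s' -> tensor_eq t t' -> tensor_eq (s ++ t) (s' ++ t')
| teq_catC s t : tensor_eq (s ++ t) (t ++ s)
| teq_zero y : tensor_eq [:: (0, y)] [::]
| teq_addl x x' y : tensor_eq [:: (x + x', y)] [:: (x, y); (x', y)]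
| teq_addr x y y' : tensor_eq [:: (x, y + y')] [:: (x, y); (x, y')]
| teq_scale a x y : tensor_eq [:: (a *: x, y)] [:: (x, a *: y)].

Definition tensor_equiv (s t : seq (M * N)) : bool := `[< tensor_eq s t >].

Lemma tensor_equiv_class : equiv_class_of tensor_equiv.
Proof.
split=> [s|s t|t s u].
- exact/asboolP/teq_refl.
- by apply/asboolP/asboolP => ?; apply: teq_sym.
- by move=> /asboolP st /asboolP tu; apply/asboolP/(teq_trans st).
Qed.

Canonical tensor_equiv_rel := EquivRelPack tensor_equiv_class.

Definition tensor := {eq_quot tensor_equiv}%qT.

End TensorProduct.

Section TensorMap.
Local Open Scope quotient_scope.
Variables (A : comPzRingType) (M M' N : lmodType A) (u : {linear M -> M'}).

(* u (x) id_N *)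
Definition tensor_map (t : tensor M N) : tensor M' N :=
  \pi [seq (u p.1, p.2) | p <- repr t].

(* Independence of the chosen representative. *)
Lemma tensor_map_pi (s : seq (M * N)) :
  tensor_map (\pi_(tensor M N) s) =
  \pi_(tensor M' N) [seq (u p.1, p.2) | p <- s].
Proof.
apply/eqmodP/asboolP.
have : tensor_eq (repr (\pi_(tensor M N) s)) s.
  by apply/asboolP; have /eqmodP := reprK (\pi_(tensor M N) s).
move: (repr _) => r; elim=> {r s} /=.
- by move=> ?; apply: teq_refl.
- by move=> ? ? _; apply: teq_sym.
- by move=> ? ? ? _ + _; apply: teq_trans.
- by move=> *; rewrite !map_cat; apply: teq_cat.
- by move=> *; rewrite !map_cat; apply: teq_catC.
- by move=> y; rewrite linear0; apply: teq_zero.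
- by move=> x x' y; rewrite linearD; apply: teq_addl.
- by move=> x y y'; apply: teq_addr.
- by move=> a x y; rewrite linearZ; apply: teq_scale.
Qed.

End TensorMap.

Definition flat (A : comPzRingType) (N : lmodType A) : Prop :=
  forall (M M' : lmodType A) (u : {linear M -> M'}),
    injective u -> injective (tensor_map (N := N) u).

(* B viewed as an A-module through f. *)
Definition restr (A B : comPzRingType) (f : {rmorphism A -> B}) : Type := B.

Section Restriction.
Variables (A B : comPzRingType) (f : {rmorphism A -> B}).

HB.instance Definition _ := GRing.Zmodule.on (restr f).

Definition restr_scale (a : A) (b : restr f) : restr f := f a * (b : B).

Fact restr_scaleA a b v :
  restr_scale a (restr_scale b v) = restr_scale (a * b) v.
Proof. by rewrite /restr_scale rmorphM mulrA. Qed.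

Fact restr_scale1 : left_id 1 restr_scale.
Proof. by move=> v; rewrite /restr_scale rmorph1 mul1r. Qed.

Fact restr_scaleDr : right_distributive restr_scale +%R.
Proof. by move=> a v w; rewrite /restr_scale mulrDr. Qed.

Fact restr_scaleDl v : {morph restr_scale^~ v : a b / a + b}.
Proof. by move=> a b; rewrite /restr_scale rmorphD mulrDl. Qed.

HB.instance Definition _ := GRing.Zmodule_isLmodule.Build A (restr f)
  restr_scaleA restr_scale1 restr_scaleDr restr_scaleDl.

End Restriction.

Section Overrings.
Variables (A K : comPzRingType) (iota : {rmorphism A -> K}).

(* K is the fraction ring of A with denominators in Reg(A), the set of the s
   with [GRing.lreg s]; since these are regular, equality of fractions amounts
   to injectivity of iota. *)
Definition total_quotient_ring : Prop :=
  [/\ injective iota,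
      forall s : A, GRing.lreg s -> exists v : K, iota s * v = 1
    & forall x : K, exists a s : A, GRing.lreg s /\ x * iota s = iota a].

(* B, with structure map f : A -> B, is identified with a subring of K
   containing A by means of j. *)
Definition overring (B : comPzRingType)
    (f : {rmorphism A -> B}) (j : {rmorphism B -> K}) : Prop :=
  injective j /\ j \o f =1 iota.

(* The notion depends only on A, as the total quotient ring is unique up to a
   unique isomorphism over A. *)
Definition perinormal : Prop :=
  forall (B : comPzRingType) (f : {rmorphism A -> B}) (j : {rmorphism B -> K}),
    overring f j -> going_down f -> flat (restr f).

End Overrings.

(* Main.v *)
(* Going up holds for integral extensions, and in the unibranched case the
   prime it produces is the given one; so A <= B has going down and B is
   A-flat.  For b in B, write s b = a with s, a in A and s regular.  By
   flatness the equality s (x) b = a (x) 1 already holds in (sA + aA) (x) B, and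
   applying s x + a y |-> y, well defined modulo I = (A : b), gives 1 in IB.
   Lying over then forces I = A, that is, b in A.
     If b^2 and b^3 are in A, then A + Ab is integral over A, and a prime Q of
   it is determined by P = Q /\ A: b is in Q iff b^2 is in P, and if b is not in Q,
   then x is in Q iff x b^2 is in P. *)
Require Import Defs.
From HB Require Import structures.
From mathcomp Require Import all_boot all_algebra ring.
From mathcomp Require Import boolp classical_sets functions.

Set Implicit Arguments.
Unset Strict Implicit.
Unset Printing Implicit Defensive.

Import GRing.Theory.

Local Open Scope classical_set_scope.
Local Open Scope ring_scope.

(** * Ideals, and primes avoiding a multiplicative set *)

Definition ideal (R : comPzRingType) (I : set R) : Prop :=
  [/\ I 0,
      forall x y, I x -> I y -> I (x + y)
    & forall a x, I x -> I (a * x)].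

Section Ideals.
Variables (R : comPzRingType) (I : set R).
Hypothesis idI : ideal I.

Lemma ideal_mulr x a : I x -> I (x * a).
Proof. by case: idI => _ _ IM Ix; rewrite mulrC; apply: IM. Qed.

Lemma ideal_opp x : I x -> I (- x).
Proof. by case: idI => _ _ IM Ix; rewrite -mulN1r; apply: IM. Qed.

Lemma ideal_sub x y : I x -> I y -> I (x - y).
Proof. by case: (idI) => _ ID _ Ix Iy; apply/ID/ideal_opp. Qed.

Lemma ideal_subl x y : I y -> I (x - y) -> I x.
Proof. by case: (idI) => _ ID _ Iy /ID /(_ Iy); rewrite subrK. Qed.

Lemma ideal_sum (J : Type) (r : seq J) (F : J -> R) :
  (forall i, I (F i)) -> I (\sum_(i <- r) F i).
Proof. by case: idI => I0 ID _ IF; elim/big_ind: _. Qed.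

Lemma ideal_add_principal c :
  ideal [set y | exists q r, I q /\ y = q + r * c].
Proof.
case: (idI) => I0 ID IM; split=> [|x y [q [r [Iq ->]]] [q' [r' [Iq' ->]]]|].
- by exists 0, 0; rewrite mul0r addr0.
- by exists (q + q'), (r + r'); split; [apply: ID | rewrite mulrDl addrACA].
- move=> a x [q [r [Iq ->]]]; exists (a * q), (a * r).
  by split; [apply: IM | rewrite mulrDr mulrA].
Qed.

Lemma ideal_congr_exp x y n : I (x - y) -> I (x ^+ n - y ^+ n).
Proof. by move=> Ixy; rewrite subrXX; apply: ideal_mulr. Qed.

End Ideals.

Section PrimeIdeals.
Variables (R : comPzRingType) (P : set R).
Hypothesis prP : prime_ideal P.

Lemma prime_is_ideal : ideal P.
Proof. by case: prP. Qed.

Lemma prime_exp x n : P (x ^+ n) -> P x.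
Proof.
case: prP => _ _ _ P1 Pp; elim: n => [|n IHn]; first by rewrite expr0.
by rewrite exprS => /Pp[].
Qed.

End PrimeIdeals.

(** An ideal [Q] maximal among those containing [I] and disjoint from [S] exists by Zorn's lemma,
    and such a [Q] is prime. The last clause records maximality: [Q + Rx] meets [S] for every [x]
    outside [Q]. *)
Lemma exists_prime_avoiding (R : comPzRingType) (I S : set R) :
  ideal I -> S 1 -> (forall x y, S x -> S y -> S (x * y)) ->
  (forall x, I x -> ~ S x) ->
  exists Q : set R, [/\ prime_ideal Q, I `<=` Q, forall x, Q x -> ~ S x
    & forall x, ~ Q x -> exists q r, Q q /\ S (q + r * x)].
Proof.
move=> idI S1 SM IS.
pose C (X : set R) := [/\ ideal X, I `<=` X & forall x, X x -> ~ S x].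
(* [Zorn_bigcup] also asks for a bound of the empty chain, hence [set0]. *)
pose D (X : set R) := X = set0 \/ C X.
have [F FD Ftot|Q [DQ Qmax]] := @Zorn_bigcup _ D.
  have [[X0 [FX0 CX0]]|noC] := pselect (exists X, F X /\ C X); last first.
    left; apply/seteqP; split=> // x [X FX Xx].
    by have [X0|CX] := FD X FX; [rewrite X0 in Xx | case: noC; exists X].
  (* A member of the chain that has an element is not the dummy [set0], so it satisfies [C]. *)
  right; have CF X x : F X -> X x -> C X.
    by move=> /FD[->|].
  have [[X00 X0D X0M] IX0 X0S] := CX0.
  split=> [|x /IX0 ?|x [X FX Xx]]; last by have [_ _] := CF X x FX Xx; apply.
    split=> [|x y [X FX Xx] [Y FY Yy]|a x [X FX Xx]]; first by exists X0.
      have [[_ XD _] _ _] := CF X x FX Xx; have [[_ YD _] _ _] := CF Y y FY Yy.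
      have [XY|YX] := Ftot X Y FX FY.
        by exists Y => //; apply: YD => //; apply: XY.
      by exists X => //; apply: XD => //; apply: YX.
    by exists X => //; have [[_ _ XM] _ _] := CF X x FX Xx; apply: XM.
  by exists X0.
have CI : C I by split.
(* The maximal element is not [set0], since [I] would be strictly larger. *)
have [Q0|CQ] := DQ.
  have [I0 _ _] := idI.
  case: (Qmax I); last by right.
  by rewrite Q0; split=> // /(_ 0 I0).
have [idQ IQ QS] := CQ.
have QSx x : ~ Q x -> exists q r, Q q /\ S (q + r * x).
  move=> nQx; apply: contrapT => noS.
  pose Y := [set y | exists q r, Q q /\ y = q + r * x].
  have QY : Q `<=` Y by move=> y Qy; exists y, 0; rewrite mul0r addr0.
  case: (Qmax Y); last first.
    right; split=> [||y [q [r [Qq ->]]] Sy]; first exact: ideal_add_principal.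
      exact: subset_trans QY.
    by apply: noS; exists q, r.
  split=> // YQ; apply/nQx/YQ; exists 0, 1; rewrite add0r mul1r.
  by split=> //; case: idQ.
have [Q0 QD QM] := idQ.
exists Q; split=> //; split=> // [/QS//|x y Qxy].
apply: contrapT => /not_orP[/QSx[q [r [Qq Sx]]] /QSx[q' [r' [Qq' Sy]]]].
(* The product of [q + r * x] and [q' + r' * y] lies in [S], but also in [Q] because [x * y]
   does. *)
apply: QS (SM _ _ Sx Sy); rewrite mulrDl; apply: (QD).
  exact: ideal_mulr.
rewrite mulrDr; apply: QD; first exact: (QM).
by rewrite mulrACA; apply: QM.
Qed.

Lemma exists_prime_over (R : comPzRingType) (I : set R) :
  ideal I -> ~ I 1 -> exists2 P, prime_ideal P & I `<=` P.
Proof.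
move=> idI I1; have [||x Ix x1|P [prP IP _ _]] :=
  @exists_prime_avoiding R I [set 1] idI; last by exists P.
- by [].
- by move=> x y -> ->; rewrite mulr1.
- by apply: I1; rewrite -x1.
Qed.

(** * Lying over, going up and going down for integral extensions *)

Section IntegralExtensions.
Variables (A B : comPzRingType) (f : {rmorphism A -> B}).

(** Any [Q] maximal among the ideals containing [J] and avoiding the image of the complement of [P]
    works. A prime [J] gives going up; [J = 0] gives lying over when [f] is injective. *)
Lemma integral_prime_lift (J : set B) (P : set A) :
  integral_ext f -> ideal J -> prime_ideal P -> f @^-1` J `<=` P ->
  exists Q, [/\ prime_ideal Q, J `<=` Q & f @^-1` Q = P].
Proof.
move=> intf idJ prP JP.
have [P0 PD PM P1 Pp] := prP; have idP := prime_is_ideal prP.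
pose S := [set y | exists2 s, ~ P s & y = f s].
have [||x Jx [s Ps xs]|Q [prQ JQ QS Qmax]] :=
  @exists_prime_avoiding B J S idJ.
- by exists 1; rewrite ?rmorph1.
- move=> _ _ [s Ps ->] [t Pt ->]; exists (s * t); last by rewrite rmorphM.
  by move=> /Pp[].
- by apply/Ps/JP; rewrite /= -xs.
have idQ := prime_is_ideal prQ.
have QP : f @^-1` Q `<=` P.
  by move=> s Qs; apply: contrapT => Ps; apply: (QS (f s)) => //; exists s.
exists Q; split=> //; apply/seteqP; split=> // p Pp0.
apply: contrapT => /Qmax[q [b [Qq [s Ps qbs]]]].
have [n [c bn]] := intf b.
(* Modulo [Q], [f s] is [b * f p], so [p ^+ n] times the integral equation of
   [b] becomes an equation over [A] for [s] with lower coefficients in [P]. *)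
have Qbs i : Q (f s ^+ i - (b * f p) ^+ i).
  by apply: ideal_congr_exp => //; rewrite -qbs addrK.
have : P (s ^+ n + \sum_(i < n) c i * p ^+ (n - i) * s ^+ i).
  apply: QP; rewrite /= rmorphD rmorphXn rmorph_sum /=.
  have -> : f s ^+ n + \sum_(i < n) f (c i * p ^+ (n - i) * s ^+ i) =
     (f s ^+ n - (b * f p) ^+ n) + \sum_(i < n)
        f (c i) * f p ^+ (n - i) * (f s ^+ i - (b * f p) ^+ i).
    (* The two sides differ by [f p ^+ n] times the integral equation of [b], which is zero. *)
    have := mul0r (f p ^+ n); rewrite -{1}bn mulrDl mulr_suml -exprMn => bpn.
    rewrite -[RHS]addr0 -[X in _ = _ + X]bpn addrACA subrK -big_split /=.
    congr (_ + _).
    apply: eq_bigr => i _; rewrite mulrBr !(rmorphM, rmorphXn) /= exprMn.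
    rewrite -[in f p ^+ n](@subnK i n) 1?ltnW // exprD.
    by rewrite [X in _ - X + _]mulrACA subrK.
  have [_ QD QM] := idQ; apply: QD => //.
  by apply: ideal_sum => // i; apply: QM.
move=> Psum; apply/Ps/(@prime_exp _ _ prP _ n).
apply: (@ideal_subl _ _ idP _
  (- \sum_(i < n) c i * p ^+ (n - i) * s ^+ i)) => //.
  (* As [i < n], the exponent [n - i] is positive, so each lower term has a factor [p] in [P]. *)
  apply: ideal_opp => //; apply: ideal_sum => // i; apply: ideal_mulr => //.
  by apply: PM; rewrite -(subnSK (ltn_ord i)) exprS; apply: ideal_mulr.
by rewrite opprK.
Qed.

Lemma unibranched_inj Q Q' : unibranched f -> Spec B Q -> Spec B Q' ->
  f @^-1` Q = f @^-1` Q' -> Q = Q'.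
Proof. by case=> _ finj _ SQ SQ'; apply: finj; apply/mem_set. Qed.

Lemma unibranched_surj P : unibranched f -> Spec A P ->
  exists2 Q, Spec B Q & f @^-1` Q = P.
Proof. by case=> _ _ fsurj /fsurj. Qed.

Lemma integral_unibranched_going_down :
  integral_ext f -> unibranched f -> going_down f.
Proof.
move=> intf unif P1 P2 Q2 prP1 prP2 P12 prQ2 Q2P2.
have [Q1 prQ1 Q1P1] := unibranched_surj unif prP1.
have [|Q [prQ Q1Q QP2]] :=
  integral_prime_lift intf (prime_is_ideal prQ1) prP2; first by rewrite Q1P1.
exists Q1; split=> //.
(* The prime [Q] over [P2] obtained by going up from [Q1] is [Q2] itself. *)
by rewrite (@unibranched_inj Q2 Q) // Q2P2 QP2.
Qed.

End IntegralExtensions.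

(** * Flatness and the conductor ideal *)

(** Modulo [T], [g] is biadditive and balanced, so it induces an additive map from the tensor
    product to [B/T]; membership in [T] replaces the quotient ring. *)
Lemma tensor_eq_sum (A B : comPzRingType) (M N : lmodType A) (T : set B)
    (g : M -> N -> B) :
  ideal T ->
  (forall y, T (g 0 y)) ->
  (forall x x' y, T (g (x + x') y - (g x y + g x' y))) ->
  (forall x y y', T (g x (y + y') - (g x y + g x y'))) ->
  (forall a x y, T (g (a *: x) y - g x (a *: y))) ->
  forall s t, tensor_eq s t ->
  T (\sum_(p <- s) g p.1 p.2 - \sum_(p <- t) g p.1 p.2).
Proof.
move=> idT g0 gDl gDr gZ s t; have [T0 TD _] := idT.
elim=> {s t} [s|s t _|s t u _ IHst _ IHtu|s s' t t' _ IHs _ IHt|s t|y|x x' y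
  |x y y'|a x y].
- by rewrite subrr.
- by rewrite -opprB => /(ideal_opp idT); rewrite !opprK.
- by rewrite -(subrKA (\sum_(p <- t) g p.1 p.2)); apply: TD.
- by rewrite !big_cat opprD addrACA; apply: TD.
- by rewrite !big_cat /= addrC subrr.
- by rewrite big_nil big_seq1 subr0.
- by rewrite !big_cons !big_nil /= !addr0.
- by rewrite !big_cons !big_nil /= !addr0.
- by rewrite !big_cons !big_nil /= !addr0.
Qed.

Section PairIdeal.
Variables (A : comPzRingType) (s a : A).

Definition in_span2 : pred A^o := fun z => `[< exists x y, z = x * s + y * a >].

Fact in_span2_submod : submod_closed in_span2.
Proof.
split=> [|c z z' /asboolP[x [y ->]] /asboolP[x' [y' ->]]]; apply/asboolP.
  by exists 0, 0; rewrite !mul0r addr0.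
exists (c * x + x'), (c * y + y').
by rewrite [c *: _]mulrDr addrACA !mulrDl !mulrA.
Qed.

HB.instance Definition _ :=
  GRing.isSubmodClosed.Build A A^o in_span2 in_span2_submod.

Definition span2 := {z : A^o | in_span2 z}.

HB.instance Definition _ := SubChoice.on span2.
HB.instance Definition _ := [SubChoice_isSubLmodule of span2 by <:].

End PairIdeal.

(* The conclusion says that (A : b)B is the unit ideal: the ideals T are those
   containing it. *)
Lemma flat_conductor (A B : comPzRingType) (f : {rmorphism A -> B}) (s a : A)
    (b : B) (T : set B) :
  flat (restr f) -> GRing.lreg (f s) -> f s * b = f a -> ideal T ->
  (forall d c, f d * b = f c -> T (f d)) -> T 1.
Proof.
move=> flatB regs sba idT Tcond; have [T0 TD TM] := idT.
have /choice[X /choice[Y XY]] (z : span2 s a) :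
    exists x y, \val z = x * s + y * a.
  by case: z => z /= /asboolP.
(* The coefficient of [a] is unique modulo [T]: two expressions of [z] give
   [(Y z - y) * a = (x - X z) * s], and cancelling [f s] puts [Y z - y] in the conductor of [b]. *)
have TY z x y : \val z = x * s + y * a -> T (f (Y z) - f y).
  rewrite XY => e; rewrite -rmorphB; apply: (Tcond _ (x - X z)).
  apply: regs; rewrite mulrCA sba -!rmorphM mulrBl mulrBr; congr (f _).
  rewrite ![s * _]mulrC; apply: (addrI (X z * s)).
  by rewrite addrA e addrK addrC subrK.
pose g (z : span2 s a) (w : restr f) : B := f (Y z) * w.
have span_s : in_span2 s a s.
  by apply/asboolP; exists 1, 0; rewrite mul1r mul0r addr0.
have span_a : in_span2 s a a.
  by apply/asboolP; exists 0, 1; rewrite mul1r mul0r add0r.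
pose zs : span2 s a := exist _ s span_s.
pose za : span2 s a := exist _ a span_a.
(* Flatness applied to the inclusion of [span2 s a] in [A]: in the larger tensor product both
   symbols equal that of [1] and [f s * b = f a]. *)
have sb_a1 : tensor_eq [:: (zs, b : restr f)] [:: (za, 1 : restr f)].
  apply/asboolP; apply/(@eqmodP _ (tensor_equiv_rel _ _)).
  apply: (flatB _ _ (\val : {linear span2 s a -> A^o}) val_inj).
  rewrite !tensor_map_pi /=; apply/eqmodP/asboolP.
  have tens1 (c : A) (w : restr f) :
      @tensor_eq A A^o (restr f) [:: (c : A^o, w)] [:: (1 : A^o, c *: w)].
    by have := @teq_scale A A^o (restr f) c 1 w; rewrite /GRing.scale /= mulr1.
  apply: teq_trans (tens1 s b) (teq_sym _).
  suff -> : s *: (b : restr f) = a *: (1 : restr f) by apply: tens1.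
  by rewrite /GRing.scale /= /restr_scale sba mulr1.
have Tg := @tensor_eq_sum A B _ _ T g idT _ _ _ _ _ _ sb_a1.
have {Tg} : T (f (Y zs) * b - f (Y za)).
  move: Tg; rewrite !big_cons !big_nil /= !addr0 /g mulr1; apply.
  - move=> w; apply: ideal_mulr => //.
    by rewrite -[f _]subr0 -(rmorph0 f); apply: (TY _ 0); rewrite !mul0r addr0.
  - move=> z z' w; rewrite -mulrDl -mulrBl -rmorphD; apply: ideal_mulr => //.
    by apply: (TY _ (X z + X z')); rewrite /= !XY !mulrDl addrACA.
  - by move=> z w w'; rewrite mulrDr subrr.
  - move=> c z w.
    rewrite [c *: w]/(f c * w) mulrA [_ * f c]mulrC -rmorphM -mulrBl.
    apply: ideal_mulr => //; apply: (TY _ (c * X z)).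
    by rewrite /= XY [c *: _]mulrDr !mulrA.
move=> Tsa.
(* From [a = 0 * s + 1 * a] and [s = 1 * s + 0 * a], [f (Y za)] is [1] and [f (Y zs)] is [0] modulo
   [T], so [Tsa] yields [1] in [T]. *)
have Ta : T (f (Y za) - 1).
  by rewrite -(rmorph1 f); apply: (TY _ 0); rewrite mul0r mul1r add0r.
have Ts : T (f (Y zs)).
  by rewrite -[f _]subr0 -(rmorph0 f); apply: (TY _ 1);
    rewrite mul0r mul1r addr0.
have : T (f (Y zs) * b - (f (Y zs) * b - f (Y za)) - (f (Y za) - 1)).
  by do 2![apply: ideal_sub => //]; apply: ideal_mulr.
by rewrite subKr opprB addrC subrK.
Qed.

(** * Flat overrings with lying over are trivial *)

Section FlatOverrings.
Variables (A K B : comPzRingType) (iota : {rmorphism A -> K}).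
Variables (f : {rmorphism A -> B}) (j : {rmorphism B -> K}).
Hypotheses (hK : total_quotient_ring iota) (ovB : overring iota f j).

(** The denominator of [j b] is invertible in [K], hence regular in [B] because [j] is injective. *)
Lemma overring_fraction b : exists s a, GRing.lreg (f s) /\ f s * b = f a.
Proof.
case: hK ovB => _ invK fracK [injj jf].
have [a [s [regs jbs]]] := fracK (j b); exists s, a; split; last first.
  by apply: injj; rewrite rmorphM /= -!/((j \o f) _) !jf mulrC.
have [v sv] := invK s regs => x y /(congr1 (fun z => v * j z)).
rewrite !rmorphM /= -!/((j \o f) _) !jf !mulrA [v * _]mulrC sv !mul1r.
exact: injj.
Qed.

Lemma flat_overring_eq :
  flat (restr f) ->
  (forall P, Spec A P -> exists2 Q, Spec B Q & f @^-1` Q = P) ->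
  range iota = range j.
Proof.
move=> flatB lying_over; have [injj jf] := ovB.
have fsurj b : exists c, f c = b.
  have [s [a [regs sba]]] := overring_fraction b.
  pose I := [set d | exists c, f d * b = f c].
  have idI : ideal I.
    split=> [|x y [c xc] [c' yc]|d x [c xc]].
    - by exists 0; rewrite rmorph0 mul0r.
    - by exists (c + c'); rewrite !rmorphD mulrDl xc yc.
    - by exists (d * c); rewrite !rmorphM -mulrA xc.
  have [[c]|I1] := pselect (I 1).
    by rewrite rmorph1 mul1r => ->; exists c.
  have [P prP IP] := exists_prime_over idI I1.
  have [Q prQ QP] := lying_over P prP.
  have [_ _ _ Q1 _] := prQ; case: Q1.
  (* [Q] lies over a prime containing the conductor [I], so it contains [IB], the unit ideal. *)
  apply: (flat_conductor flatB regs sba (prime_is_ideal prQ)) => d c dc.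
  suff : P d by rewrite -QP.
  by apply: IP; exists c.
apply/seteqP; split=> [_ [c _ <-]|_ [b _ <-]].
  by exists (f c) => //; apply: jf.
by have [c <-] := fsurj b; exists c => //; rewrite -jf.
Qed.

End FlatOverrings.

(** * Subrings of [K] containing [A], as overrings *)

Section Subring.
Variables (A K : comPzRingType) (iota : {rmorphism A -> K}) (X : pred K).
Hypotheses (ringX : subring_closed X) (iotaX : forall a, X (iota a)).

Definition subring := {x : K | X x}.

HB.instance Definition _ := SubChoice.on subring.
HB.instance Definition _ :=
  GRing.SubChoice_isSubComPzRing.Build K X subring ringX.

Definition corestr (a : A) : subring := exist _ (iota a) (iotaX a).

Fact corestr_zmod_morphism : zmod_morphism corestr.
Proof. by move=> a c; apply: val_inj; rewrite /= rmorphB. Qed.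

Fact corestr_monoid_morphism : monoid_morphism corestr.
Proof.
by split=> [|a c]; apply: val_inj; rewrite /= ?rmorph1 ?rmorphM.
Qed.

HB.instance Definition _ :=
  GRing.isZmodMorphism.Build A subring corestr corestr_zmod_morphism.
HB.instance Definition _ :=
  GRing.isMonoidMorphism.Build A subring corestr corestr_monoid_morphism.

Lemma overring_of_subring :
  exists (B : comPzRingType) (f : {rmorphism A -> B}) (j : {rmorphism B -> K}),
    overring iota f j /\ range j = [set x | X x].
Proof.
exists subring, corestr, (\val : {rmorphism subring -> K}).
split; first by split=> //; apply: val_inj.
apply/seteqP; split=> [_ [x _ <-]|x Xx]; first exact: (valP x).
by exists (exist _ x Xx).
Qed.

End Subring.

(** * Extensions [A + Ab] with [b ^+ 2] and [b ^+ 3] in [A] *)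

Section CuspidalExtension.
Variables (A B : comPzRingType) (f : {rmorphism A -> B}) (b : B) (u v : A).
Hypotheses (injf : injective f) (b2 : b ^+ 2 = f u) (b3 : b ^+ 3 = f v).
Hypothesis genB : forall x, exists a c, x = f a + f c * b.

Lemma cuspidal_integral : integral_ext f.
Proof.
move=> x; have [a [c ->]] := genB x.
(* The equation is [(x - a)^2 = c^2 u], expanded. *)
exists 2%N, (fun i => if i == 0 then a ^+ 2 - c ^+ 2 * u else - (a + a)).
rewrite !big_ord_recl big_ord0 /= addr0 expr0 expr1 mulr1.
rewrite !(rmorphD, rmorphN) [f (_ * u)]rmorphM !rmorphXn /= -b2; ring.
Qed.

Lemma cuspidal_prime_sub (Q Q' : set B) :
  prime_ideal Q -> prime_ideal Q' -> f @^-1` Q = f @^-1` Q' -> Q `<=` Q'.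
Proof.
move=> prQ prQ' QQ' x Qx.
have QQ'f a : Q (f a) -> Q' (f a) by rewrite -[Q _]/((f @^-1` Q) a) QQ'.
have Q'Qf a : Q' (f a) -> Q (f a) by rewrite -[Q' _]/((f @^-1` Q') a) -QQ'.
have idQ := prime_is_ideal prQ; have idQ' := prime_is_ideal prQ'.
have [_ Q'D Q'M _ Q'p] := prQ'.
have [a [c xac]] := genB x.
have [Q'b|Q'b] := pselect (Q' b).
  have Qb : Q b.
    by apply: (prime_exp prQ (n := 2)); rewrite b2; apply: Q'Qf; rewrite -b2;
      apply: ideal_mulr.
  rewrite xac; apply: Q'D; last exact: Q'M.
  apply: QQ'f; rewrite -[f a](addrK (f c * b)) -xac.
  by apply: ideal_sub => //; case: idQ => _ _; apply.
(* With [b] outside [Q'], multiplying by [b ^+ 2] moves [x] into [A], where [Q] and [Q'] agree. *)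
have : Q' (x * b ^+ 2).
  have xb2 : x * b ^+ 2 = f (a * u + c * v).
    rewrite xac mulrDl -mulrA -exprS b2 b3.
    by rewrite rmorphD !rmorphM.
  by rewrite xb2; apply: QQ'f; rewrite -xb2; apply: ideal_mulr.
by move=> /Q'p[//|/(prime_exp prQ')].
Qed.

Lemma cuspidal_unibranched : unibranched f.
Proof.
split.
- move=> Q [Q0 QD QM Q1 Qp]; split=> /=.
  + by rewrite rmorph0.
  + by move=> x y Qx Qy; rewrite rmorphD; apply: QD.
  + by move=> a x Qx; rewrite rmorphM; apply: QM.
  + by rewrite rmorph1.
  + by move=> x y; rewrite rmorphM => /Qp.
- move=> Q Q'; rewrite !inE => prQ prQ' QQ'.
  by apply/seteqP; split; apply: cuspidal_prime_sub.
- move=> P prP; have [P0 _ _ _ _] := prP.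
  have id0 : ideal [set (0 : B)].
    by split=> [//|x y -> ->|a x ->]; rewrite ?addr0 ?mulr0.
  have [|Q [prQ _ QP]] := integral_prime_lift cuspidal_integral id0 prP.
    by move=> x /= fx0; have -> : x = 0 by apply: injf; rewrite rmorph0.
  by exists Q.
Qed.

End CuspidalExtension.

(** Products stay in [A + Ab] since [b ^+ 2] is in [A]; this is the ring [A[b]]. *)
Lemma square_adjunction_subring (A K : comPzRingType)
    (iota : {rmorphism A -> K}) (b : K) (u : A) :
  b ^+ 2 = iota u ->
  subring_closed (fun x => `[< exists a c, x = iota a + iota c * b >]).
Proof.
move=> b2; split=> [|x y /asboolP[a [c ->]] /asboolP[a' [c' ->]]
  |x y /asboolP[a [c ->]] /asboolP[a' [c' ->]]]; apply/asboolP.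
- by exists 1, 0; rewrite rmorph1 rmorph0 mul0r addr0.
- exists (a - a'), (c - c').
  by rewrite !rmorphB mulrBl opprD addrACA.
- exists (a * a' + c * c' * u), (a * c' + c * a').
  rewrite !rmorphD !rmorphM /= -b2; ring.
Qed.

Theorem proposition8 (A K : comPzRingType) (iota : {rmorphism A -> K})
    (hK : total_quotient_ring iota) (hA : perinormal iota) :
  (forall (B : comPzRingType) (f : {rmorphism A -> B})
      (j : {rmorphism B -> K}),
     overring iota f j -> integral_ext f -> unibranched f ->
     range iota = range j)
  /\
  (forall b : K, range iota (b ^+ 2) -> range iota (b ^+ 3) ->
     range iota b).
Proof.
have integral_eq (B : comPzRingType) (f : {rmorphism A -> B})
    (j : {rmorphism B -> K}) : overring iota f j -> integral_ext f ->
    unibranched f -> range iota = range j.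
  move=> ovB intf unif; apply: (flat_overring_eq hK ovB).
    exact: hA ovB (integral_unibranched_going_down intf unif).
  by move=> P; apply: unibranched_surj.
split=> // b [u _ b2] [v _ b3].
have subX := square_adjunction_subring (esym b2).
have [|B [f [j [ovB jB]]]] := overring_of_subring (iota := iota) subX.
  by move=> a; apply/asboolP; exists a, 0; rewrite rmorph0 mul0r addr0.
have [injj jf] := ovB; have [inji _ _] := hK.
(* [b'] is [b] seen in the abstract copy [B] of [A[b]]; the relations are pulled back along the
   injective [j]. *)
have [b' _ jb] : range j b.
  by rewrite jB; apply/asboolP; exists 0, 1; rewrite rmorph0
    rmorph1 mul1r add0r.
have injf : injective f.
  by move=> x y fxy; apply: inji; rewrite -!jf /= fxy.
have b2' : b' ^+ 2 = f u.
  by apply: injj; rewrite rmorphXn /= jb -b2 -jf.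
have b3' : b' ^+ 3 = f v.
  by apply: injj; rewrite rmorphXn /= jb -b3 -jf.
have genB x : exists a c, x = f a + f c * b'.
  have : range j (j x) by exists x.
  rewrite jB => /asboolP[a [c jx]]; exists a, c; apply: injj.
  by rewrite jx rmorphD rmorphM /= jb -!jf.
rewrite (integral_eq B f j) //; first by exists b'.
  exact: cuspidal_integral b2' genB.
exact: cuspidal_unibranched injf b2' b3' genB.
Qed.
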